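(* Let $\Omega\subset\mathbb{R}^n$ be a bounded domain and let $(u,v)$ solve $$u_t=d_1\Delta u+a_1u-b_1u^2-c_1uv,\qquad v_t=d_2\Delta v+\frac{a_2v}{1+k(x)u}-b_2v^2-c_2uv\quad\text{in }\Omega\times(0,\infty),$$ with $\partial_\nu u=\partial_\nu v=0$ on $\partial\Omega$ and constant initial data $u(x,0)\equiv c>0$, $v(x,0)\equiv d>0$, where $k$ satisfies the standing assumptions below. Let $\tilde k=\max_{x\in\overline\Omega}k(x)$. If $$\tilde k>\frac{a_2b_1^2-c_2a_1b_1}{a_1^2c_2}\quad\text{and}\quad\frac{a_1}{a_2}>\max\left\{\frac{b_1}{c_2},\frac{c_1}{b_2}\right\},$$ then $(u,v)$ converges uniformly on $\Omega$ to $(\frac{a_1}{b_1},0)$ as $t\to\infty$.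
   Context: Standing assumptions on $k$: $k\in C^1(\overline\Omega)$, $k\ge0$, and $k$ vanishes only on a set of Lebesgue measure zero. All parameters $a_i,b_i,c_i,d_i$ are positive. *)

(* Defs.v *)
From HB Require Import structures.
From mathcomp Require Import all_boot all_order all_algebra.
From mathcomp Require Import all_classical all_reals all_analysis.
Set Implicit Arguments. Unset Strict Implicit. Unset Printing Implicit Defensive.
Import Order.TTheory GRing.Theory Num.Theory.
Import numFieldNormedType.Exports.
Local Open Scope classical_set_scope.
Local Open Scope ring_scope.

Definition evec {R : realType} {n : nat} (i : 'I_n) : 'rV[R]_n := delta_mx 0 i.

Definition pd {R : realType} {n : nat} (i : 'I_n) (f : 'rV[R]_n -> R) : 'rV[R]_n -> R :=
  fun x => 'D_(evec i) f x.

Definition laplacian {R : realType} {n : nat} (f : 'rV[R]_n -> R) (x : 'rV[R]_n) : R :=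
  \sum_(i < n) pd i (pd i f) x.

Definition gradient {R : realType} {n : nat} (f : 'rV[R]_n -> R) (x : 'rV[R]_n) : 'rV[R]_n :=
  \row_i pd i f x.

Definition euclid_norm {R : realType} {n : nat} (x : 'rV[R]_n) : R :=
  Num.sqrt (\sum_(i < n) x 0 i ^+ 2).

(* Omega is a bounded domain with C^1 boundary, described by a C^1 defining
   function rho : Omega = {rho < 0}, closure Omega = {rho <= 0}, and
   grad rho <> 0 on the boundary {rho = 0}. *)
Definition C1_defining_function {R : realType} {n : nat}
  (Omega : set 'rV[R]_n) (rho : 'rV[R]_n -> R) : Prop :=
  (forall x, differentiable rho x) /\
  (forall i, continuous (pd i rho)) /\
  Omega = [set x | rho x < 0] /\
  closure Omega = [set x | rho x <= 0] /\
  (forall x, rho x = 0 -> gradient rho x != 0).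

Definition outward_normal {R : realType} {n : nat} (rho : 'rV[R]_n -> R) (x : 'rV[R]_n)
  : 'rV[R]_n := (euclid_norm (gradient rho x))^-1 *: gradient rho x.

Definition box_vol {R : realType} {n : nat} (a b : 'rV[R]_n) : R :=
  \prod_(i < n) (b 0 i - a 0 i).

Definition box {R : realType} {n : nat} (a b : 'rV[R]_n) : set 'rV[R]_n :=
  [set x | forall i, a 0 i <= x 0 i <= b 0 i].

Definition lebesgue_null {R : realType} {n : nat} (A : set 'rV[R]_n) : Prop :=
  forall eps : R, 0 < eps ->
    exists a b : nat -> 'rV[R]_n,
      (forall m i, a m 0 i <= b m 0 i) /\
      A `<=` \bigcup_m box (a m) (b m) /\
      (forall N, \sum_(m < N) box_vol (a m) (b m) < eps).

Definition C1_closure {R : realType} {n : nat} (Omega : set 'rV[R]_n) (k : 'rV[R]_n -> R) : Prop :=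
  {within closure Omega, continuous k} /\
  (forall x, Omega x -> differentiable k x) /\
  (forall i, exists g : 'rV[R]_n -> R,
      {within closure Omega, continuous g} /\ forall x, Omega x -> pd i k x = g x).

Definition C21 {R : realType} {n : nat} (Omega : set 'rV[R]_n) (f : 'rV[R]_n -> R -> R) : Prop :=
  (forall x t, Omega x -> 0 < t ->
     derivable (f x) t 1 /\
     forall i, (\forall y \near x, derivable (f ^~ t) y (evec i)) /\
               (forall j, derivable (pd j (f ^~ t)) x (evec i))) /\
  {within [set p : 'rV[R]_n * R | Omega p.1 /\ 0 < p.2],
     continuous (fun p => 'D_1 (f p.1) p.2)} /\
  (forall i j, {within [set p : 'rV[R]_n * R | Omega p.1 /\ 0 < p.2],
     continuous (fun p => pd j (pd i (f ^~ p.2)) p.1)}) /\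
  (forall i, {within [set p : 'rV[R]_n * R | Omega p.1 /\ 0 < p.2],
     continuous (fun p => pd i (f ^~ p.2) p.1)}).

Definition neumann_at {R : realType} {n : nat} (rho : 'rV[R]_n -> R)
  (f : 'rV[R]_n -> R -> R) (x : 'rV[R]_n) (t : R) : Prop :=
  (fun h : R => (f x t - f (x - h *: outward_normal rho x) t) / h) @ 0^'+ --> 0.

Definition is_solution {R : realType} {n : nat} (Omega : set 'rV[R]_n)
  (rho : 'rV[R]_n -> R) (k : 'rV[R]_n -> R)
  (a1 a2 b1 b2 c1 c2 d1 d2 c d : R) (u v : 'rV[R]_n -> R -> R) : Prop :=
  {within [set p : 'rV[R]_n * R | closure Omega p.1 /\ 0 <= p.2],
     continuous (fun p => u p.1 p.2)} /\
  {within [set p : 'rV[R]_n * R | closure Omega p.1 /\ 0 <= p.2],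
     continuous (fun p => v p.1 p.2)} /\
  C21 Omega u /\ C21 Omega v /\
  (forall x t, Omega x -> 0 < t ->
     'D_1 (u x) t = d1 * laplacian (u ^~ t) x + a1 * u x t - b1 * u x t ^+ 2
                    - c1 * u x t * v x t) /\
  (forall x t, Omega x -> 0 < t ->
     'D_1 (v x) t = d2 * laplacian (v ^~ t) x + a2 * v x t / (1 + k x * u x t)
                    - b2 * v x t ^+ 2 - c2 * u x t * v x t) /\
  (forall x t, rho x = 0 -> 0 < t -> neumann_at rho u x t /\ neumann_at rho v x t) /\
  (forall x, closure Omega x -> u x 0 = c /\ v x 0 = d).

(* Main.v *)
(** Since [a2 / (1 + k u) <= a2], [v] is a subsolution of the classical
    Lotka-Volterra equation, so [(u, v)] can be compared with spatially constant
    barriers.  After [v] has dropped below a value between [a2/b2] and [a1/c1],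
    the affine functions [a1 - b1 al - c1 be] and [b2 be + c2 al - a2] are positive
    at both ends of a segment from [(al0, be0)] to a point [(al1, be1)] near
    [(a1/b1, 0)], hence along it, and the rectangles [u >= al, v <= be] stay
    invariant while their corner moves slowly along the segment.  The upper bound
    for [u] is logistic decay.

    The boundary being only C^1, Hopf's lemma is not available.  The comparison
    principle instead perturbs by the inf-convolution
    [inf_y (rho y + L |x - y|^2)] of the defining function: at every point it is
    touched from above by a paraboloid with gradient [grad rho y], [y] close to
    [x], so its normal derivative on the boundary is positive. *)

Require Import Defs.
From HB Require Import structures.
From mathcomp Require Import all_boot all_order all_algebra.
From mathcomp Require Import all_classical all_reals all_analysis.
From mathcomp Require Import ring lra.
Import Order.TTheory GRing.Theory Num.Theory.
Import numFieldNormedType.Exports.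
Local Open Scope classical_set_scope.
Local Open Scope ring_scope.

Set Implicit Arguments.
Unset Strict Implicit.
Unset Printing Implicit Defensive.

(** * Derivative tests on the line *)

Lemma is_derive_line (R : realType) (V : normedModType R) (f : V -> R) (x v : V) (h : R) :
  derivable f (x + h *: v) v ->
  is_derive h 1 (fun s : R => f (x + s *: v)) ('D_v f (x + h *: v)).
Proof.
have E : (fun k : R => k^-1 *: (f (x + (k *: (1 : R) + h) *: v) - f (x + h *: v))) =
         (fun k : R => k^-1 *: (f (k *: v + (x + h *: v)) - f (x + h *: v))).
  apply/funext => k; congr (_ *: (f _ - _)).
  by rewrite scalerDl -[k *: 1]/(k * 1) mulr1 addrCA.
move=> df; apply: DeriveDef.
  by rewrite /derivable E.
by rewrite /derive E.
Qed.

Lemma nbhs0_itv (R : realType) (P : R -> Prop) : (\forall h \near (0 : R), P h) ->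
  exists2 e : R, 0 < e & forall h, - e < h < e -> P h.
Proof.
case/nbhs_ballP => e /= e0 H; exists e => // h he; apply: H.
by rewrite /ball /= sub0r normrN ltr_norml.
Qed.

Lemma is_derive_local_min (R : realType) (g : R -> R) (m : R) :
  (\forall h \near (0 : R), derivable g h 1) -> is_derive (0 : R) 1 g m ->
  (\forall h \near (0 : R), g 0 <= g h) -> m = 0.
Proof.
move=> dg g0 gmin.
have [e e0 H] : exists2 e : R, 0 < e & forall h, - e < h < e -> derivable g h 1 /\ g 0 <= g h.
  by apply: nbhs0_itv; near=> h; split; near: h.
have e2 : - e <= e by lra.
have d0 : is_derive (0 : R) 1 g 0.
  apply: (@derive1_at_min R g (- e) e 0 e2).
  - by move=> t; rewrite in_itv /= => /H[].
  - by rewrite in_itv /=; lra.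
  - by move=> t; rewrite in_itv /= => /H[].
by case: g0 => _ <-; case: d0.
Unshelve. all: by end_near. Qed.

Lemma second_derivative_local_min (R : realType) (g g' : R -> R) (m : R) :
  (\forall h \near (0 : R), is_derive (h : R) 1 g (g' h)) -> is_derive (0 : R) 1 g' m ->
  (\forall h \near (0 : R), g 0 <= g h) -> 0 <= m.
Proof.
move=> dg dg' gmin.
have g'0 : g' 0 = 0.
  apply: (@is_derive_local_min _ g) => //; last exact: (nbhs_singleton dg).
  by near=> h; have [] : is_derive (h : R) 1 g (g' h) by near: h.
rewrite leNgt; apply/negP => m0.
have [dg'0 Dg'0] := dg'.
have /cvgrPdist_lt/(_ (- m)) : (fun h : R => h^-1 *: (g' (h *: (1 : R) + 0) - g' 0)) @ 0^' --> m.
  by rewrite -Dg'0; exact: dg'0.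
rewrite oppr_gt0 => /(_ m0) neg.
have [e e0 H] : exists2 e : R, 0 < e & forall h, - e < h < e ->
    [/\ is_derive (h : R) 1 g (g' h), g 0 <= g h & h != 0 -> `|m - h^-1 * g' h| < - m].
  apply: nbhs0_itv; near=> h; split.
  - by near: h.
  - by near: h.
  - near: h; move: neg; rewrite /dnbhs near_withinE; apply: filterS => h H h0.
    by have := H h0; rewrite addr0 g'0 subr0 -[h *: 1]/(h * 1) mulr1.
have e2 : 0 < e / 2 by lra.
have [||c] := @MVT R g g' 0 (e / 2) e2.
- by move=> x; rewrite in_itv /= => xe; have [|//] := H x; lra.
- apply: derivable_within_continuous => x; rewrite in_itv /= => xe.
  by have [|[]//] := H x; lra.
rewrite in_itv /= => /andP[c0 ce] E.
have [|_ _] := H c; first by lra.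
rewrite gt_eqF // => /(_ isT); rewrite ltr_norml => /andP[Hc _].
have : c^-1 * g' c < 0 by lra.
rewrite pmulr_rlt0 ?invr_gt0 // => gc.
have [|_ + _] := H (e / 2); first by lra.
have : g' c * (e / 2) < 0 by rewrite nmulr_rlt0 //; lra.
by rewrite subr0 in E; lra.
Unshelve. all: by end_near. Qed.

Lemma derivative_left_min (R : realType) (g : R -> R) (t m e : R) : 0 < e ->
  is_derive t 1 g m -> (forall s, t - e < s < t -> g t <= g s) -> m <= 0.
Proof.
move=> e0 [dg Dg] gmin; rewrite leNgt; apply/negP => m0.
have /cvgrPdist_lt/(_ m m0) : (fun h : R => h^-1 *: (g (h *: (1 : R) + t) - g t)) @ 0^' --> m.
  by rewrite -Dg; exact: dg.
rewrite /dnbhs near_withinE => /nbhs0_itv[d d0 H].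
pose h := - (Num.min d e / 2).
have md : Num.min d e <= d by rewrite ge_min lexx.
have me : Num.min d e <= e by rewrite ge_min lexx orbT.
have mp : 0 < Num.min d e by rewrite lt_min d0 e0.
have h0 : h < 0 by rewrite /h; lra.
have := H h; rewrite lt_eqF // -[h *: 1]/(h * 1) mulr1.
have -> : - d < h < d by rewrite /h; lra.
move=> /(_ isT isT); rewrite ltr_norml => /andP[_].
have : g t <= g (h + t) by apply: gmin; rewrite /h; lra.
rewrite -subr_ge0 => Hg.
have : h^-1 * (g (h + t) - g t) <= 0 by rewrite mulr_le0_ge0 // invr_le0 ltW.
rewrite -[h^-1 *: _]/(h^-1 * _); lra.
Qed.

(** * Touching by paraboloids *)

Definition sqdist {R : realType} {n : nat} (x y : 'rV[R]_n) : R :=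
  \sum_(i < n) (x 0 i - y 0 i) ^+ 2.

Lemma sqdist_ge0 (R : realType) (n : nat) (x y : 'rV[R]_n) : 0 <= sqdist x y.
Proof. by apply: sumr_ge0 => i _; exact: sqr_ge0. Qed.

Lemma sqdistC (R : realType) (n : nat) (x y : 'rV[R]_n) : sqdist x y = sqdist y x.
Proof. by apply: eq_bigr => i _; rewrite -sqrrN opprB. Qed.

Lemma sqdistxx (R : realType) (n : nat) (x : 'rV[R]_n) : sqdist x x = 0.
Proof. by apply: big1 => i _; rewrite subrr expr0n. Qed.

Lemma sqdist_line (R : realType) (n : nat) (x y v : 'rV[R]_n) (h : R) :
  sqdist (x + h *: v) y =
  sqdist x y + (2 * \sum_(i < n) v 0 i * (x 0 i - y 0 i)) * h + sqdist v 0 * h ^+ 2.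
Proof.
rewrite /sqdist mulr_sumr !mulr_suml -!big_split /=; apply: eq_bigr => i _.
by rewrite !mxE; ring.
Qed.

Lemma evecE (R : realType) (n : nat) (i j : 'I_n) : (evec i : 'rV[R]_n) 0 j = (j == i)%:R.
Proof. by rewrite mxE eqxx. Qed.

Lemma sqdist_evec (R : realType) (n : nat) (x y : 'rV[R]_n) (i : 'I_n) (h : R) :
  sqdist (x + h *: evec i) y = sqdist x y + (2 * (x 0 i - y 0 i)) * h + 1 * h ^+ 2.
Proof.
rewrite sqdist_line; congr (_ + (2 * _) * _ + _ * _).
  rewrite (bigD1 i) //= evecE eqxx mul1r big1 ?addr0 // => j ji.
  by rewrite evecE (negbTE ji) mul0r.
rewrite /sqdist (bigD1 i) //= big1 => [|j ji]; rewrite !evecE mxE subr0.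
  by rewrite eqxx expr1n addr0.
by rewrite (negbTE ji) expr0n.
Qed.

Lemma is_derive_lincomb (R : realType) (f g : R -> R) (a b h df dg : R) :
  is_derive h 1 f df -> is_derive h 1 g dg ->
  is_derive h 1 (fun h => a * f h + b * g h) (a * df + b * dg).
Proof. by move=> Hf Hg; exact: (is_deriveD (is_deriveZ a Hf) (is_deriveZ b Hg)). Qed.

Lemma is_derive_quadratic (R : realType) (a b c h : R) :
  is_derive h 1 (fun h : R => a + b * h + c * h ^+ 2) (b + 2 * c * h).
Proof.
have H := is_deriveD (is_deriveD (is_derive_cst a h 1) (is_deriveZ b (is_derive_id h 1)))
  (is_deriveZ c (is_deriveX 2 (is_derive_id h 1))).
apply: (is_derive_eq H).
rewrite -[b *: 1]/(b * 1) -[c *: _]/(c * ((2%:R * h ^+ 1) * 1)).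
by ring.
Qed.

Lemma nbhs_line (R : realType) (n : nat) (x v : 'rV[R]_n) (P : 'rV[R]_n -> Prop) :
  (\forall y \near x, P y) -> \forall h \near (0 : R), P (x + h *: v).
Proof.
have c : (x + h *: v) @[h --> (0 : R)] --> x.
  rewrite -[X in _ --> X]addr0; apply: cvgD; first exact: cvg_cst.
  by rewrite -(scale0r v); apply: cvgZr_tmp; exact: cvg_id.
by move=> H; exact: (c _ H).
Qed.

Lemma derive_pd (R : realType) (n : nat) (f : 'rV[R]_n -> R) (x v : 'rV[R]_n) :
  differentiable f x -> 'D_v f x = \sum_(i < n) v 0 i * pd i f x.
Proof.
move=> df; rewrite deriveE // {1}(row_sum_delta v) linear_sum; apply: eq_bigr => i _.
by rewrite linearZ /= /pd deriveE.
Qed.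

Lemma outward_normal_grad (R : realType) (n : nat) (rho : 'rV[R]_n -> R) (x w : 'rV[R]_n) :
  \sum_(i < n) outward_normal rho x 0 i * w 0 i =
  (euclid_norm (gradient rho x))^-1 * \sum_(i < n) pd i rho x * w 0 i.
Proof. by rewrite mulr_sumr; apply: eq_bigr => i _; rewrite !mxE mulrA. Qed.

Lemma gradient_sqr_gt0 (R : realType) (n : nat) (rho : 'rV[R]_n -> R) (x : 'rV[R]_n) :
  gradient rho x != 0 -> 0 < \sum_(i < n) pd i rho x * pd i rho x.
Proof.
case/rV0Pn => i; rewrite mxE => gi.
rewrite (bigD1 i) //= ltr_pwDl //; first by rewrite -expr2 exprn_even_gt0.
by apply: sumr_ge0 => j _; rewrite -expr2 sqr_ge0.
Qed.

Lemma euclid_norm_gradient_gt0 (R : realType) (n : nat) (rho : 'rV[R]_n -> R) (x : 'rV[R]_n) :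
  gradient rho x != 0 -> 0 < euclid_norm (gradient rho x).
Proof.
move=> /gradient_sqr_gt0 g0; rewrite sqrtr_gt0; congr (0 < _): g0.
by apply: eq_bigr => i _; rewrite mxE -expr2.
Qed.

Lemma inward_normal_mem (R : realType) (n : nat) (Omega : set 'rV[R]_n) rho (x : 'rV[R]_n) :
  C1_defining_function Omega rho -> rho x = 0 ->
  \forall h \near (0 : R)^'+, Omega (x - h *: outward_normal rho x).
Proof.
move=> [drho [_ [-> [_ grad]]]] rx.
set v := outward_normal rho x.
have gx := grad _ rx.
have Dv : 0 < 'D_v rho x.
  rewrite derive_pd //.
  have -> : \sum_(i < n) v 0 i * pd i rho x = \sum_(i < n) v 0 i * gradient rho x 0 i.
    by apply: eq_bigr => i _; rewrite !mxE.
  rewrite outward_normal_grad mulr_gt0 ?invr_gt0 ?euclid_norm_gradient_gt0 //.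
  rewrite (_ : \sum_(i < n) _ = \sum_(i < n) pd i rho x * pd i rho x); last first.
    by apply: eq_bigr => i _; rewrite mxE.
  exact: gradient_sqr_gt0.
have /cvgrPdist_lt/(_ _ Dv) : (fun h : R => h^-1 *: (rho (h *: v + x) - rho x)) @ 0^' --> 'D_v rho x.
  exact: diff_derivable.
rewrite /dnbhs near_withinE => /nbhs0_itv[e e0 H].
near=> h => /=.
have h0 : 0 < h by near: h; exact: nbhs_right_gt.
have he : h < e by near: h; exact: nbhs_right_lt.
have := H (- h); rewrite oppr_eq0 gt_eqF // => /(_ _ isT).
have -> : - e < - h < e by lra.
move=> /(_ isT); rewrite rx subr0 ltr_norml => /andP[_].
rewrite -[_ *: rho _]/((- h)^-1 * rho _) scaleNr (addrC (- _)).
rewrite ltrBlDl -ltrBlDr subrr invrN mulNr oppr_gt0 pmulr_rlt0 // ?invr_gt0 //.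
Unshelve. all: by end_near. Qed.

Lemma compact_normr_le (R : realType) (n : nat) (M : R) :
  compact [set x : 'rV[R]_n | `|x| <= M].
Proof.
apply: bounded_closed_compact.
  by exists M; split; [exact: num_real|move=> K MK x /= xM]; exact: le_trans xM (ltW MK).
apply: (@preimage_closed _ _ (fun x : 'rV[R]_n => `|x|) [set r | r <= M]); last exact: closed_le.
by move=> x _; exact: norm_continuous.
Qed.

Lemma closure_normr_le (R : realType) (n : nat) (A : set 'rV[R]_n) :
  bounded_set A -> exists2 M : R, 0 < M & forall x, closure A x -> `|x| <= M.
Proof.
move=> /pinfty_ex_gt0[M M0 AM]; exists M => // x.
have cl : closed [set x : 'rV[R]_n | `|x| <= M].
  by apply: compact_closed; [exact: norm_hausdorff|exact: compact_normr_le].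
by move=> /(closureS AM); rewrite -((closure_id _).1 cl).
Qed.

Lemma compact_closure (R : realType) (n : nat) (A : set 'rV[R]_n) :
  bounded_set A -> compact (closure A).
Proof.
move=> /closure_normr_le[M _ AM].
exact: subclosed_compact (@closed_closure _ A) (@compact_normr_le R n M) AM.
Qed.

Lemma sqdist_ball (R : realType) (n : nat) (x y : 'rV[R]_n) (r : R) :
  0 < r -> sqdist x y < r ^+ 2 -> ball x r y.
Proof.
move=> r0 xy; split => // i j; rewrite ord1 /ball /=.
have H : `|x 0 j - y 0 j| ^+ 2 < r ^+ 2.
  rewrite real_normK ?num_real //; apply: le_lt_trans xy.
  by rewrite /sqdist (bigD1 j) //= lerDl; apply: sumr_ge0 => k _; exact: sqr_ge0.
by move: H; rewrite ltr_pXn2r // nnegrE ?normr_ge0 // ltW.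
Qed.

Lemma normals_stable (R : realType) (n : nat) (Omega : set 'rV[R]_n) rho :
  bounded_set Omega -> C1_defining_function Omega rho ->
  exists2 r : R, 0 < r & forall x y : 'rV[R]_n, rho x = 0 -> ball x r y ->
    0 < \sum_(i < n) pd i rho x * pd i rho y.
Proof.
move=> bO [drho [crho [_ [cl grad]]]].
have crho0 : continuous rho by move=> x; exact: differentiable_continuous.
have cA : compact [set x | rho x = 0].
  apply: (@subclosed_compact _ _ (closure Omega)).
  - by apply: (@preimage_closed _ _ rho [set 0]); [move=> x _; exact: crho0|exact: closed_eq].
  - exact: compact_closure.
  - by move=> x /= rx; rewrite cl /= rx.
pose P (r : R) x := forall y, ball x r y -> 0 < \sum_(i < n) pd i rho x * pd i rho y.
have Pr : \forall r \near (0 : R)^'+, [set x | rho x = 0] `<=` P r.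
  move/compact_near_coveringP: cA; apply => x /= rx.
  pose G (p : 'rV[R]_n * 'rV[R]_n) := \sum_(i < n) pd i rho p.1 * pd i rho p.2.
  have cG : G p @[p --> (x, x)] --> G (x, x).
    apply: cvg_big => [|i _]; [exact: add_continuous|apply: cvgM].
      by apply: (@cvg_comp _ _ _ fst (pd i rho) _ (nbhs x)); [exact: cvg_fst|exact: crho].
    by apply: (@cvg_comp _ _ _ snd (pd i rho) _ (nbhs x)); [exact: cvg_snd|exact: crho].
  have G0 : 0 < G (x, x) by apply: gradient_sqr_gt0; exact: grad.
  have Gp : \forall p \near (x, x), 0 < G p by exact: (cvgr_gt _ cG).
  move/nbhs_ballP: Gp => [e /= e0 He].
  near=> x' r.
  have b1 : ball x (e / 2) x'.
    by near: x'; apply: nbhsx_ballx; lra.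
  have re : r <= e / 2 by near: r; apply: nbhs_right_le; lra.
  move=> y xy.
  apply: (He (x', y)); split => /=.
    by apply: le_ball b1; lra.
  rewrite (splitr e); apply: ball_triangle b1 _; exact: le_ball xy.
have [r [r0 Hr]] := filter_ex (filterI (nbhs_right_gt (0 : R)) Pr).
by exists r => // x y rx; exact: Hr.
Unshelve. all: by end_near. Qed.

Lemma no_touching_at_boundary (R : realType) (n : nat) (Omega : set 'rV[R]_n) rho
    (f : 'rV[R]_n -> R -> R) (x y : 'rV[R]_n) (t s e L : R) :
  C1_defining_function Omega rho -> rho x = 0 -> neumann_at rho f x t -> 0 < e ->
  (forall i, pd i rho y = 2 * L * (x 0 i - y 0 i)) ->
  0 < \sum_(i < n) pd i rho x * pd i rho y ->
  ~ (forall z, Omega z -> s * f x t + e * (L * sqdist x y) <= s * f z t + e * (L * sqdist z y)).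
Proof.
move=> Crho rx N e0 gy pos min.
set v := outward_normal rho x.
pose A := \sum_(i < n) v 0 i * (x 0 i - y 0 i).
have A0 : 0 < 2 * L * A.
  have -> : 2 * L * A = \sum_(i < n) v 0 i * gradient rho y 0 i.
    by rewrite mulr_sumr; apply: eq_bigr => i _; rewrite [gradient _ _ _ _]mxE gy; ring.
  rewrite outward_normal_grad mulr_gt0 ?invr_gt0 ?euclid_norm_gradient_gt0 //.
    by case: Crho => [_ [_ [_ [_]]]]; exact.
  by congr (0 < _): pos; apply: eq_bigr => i _; rewrite mxE.
pose C := L * sqdist v 0.
have lim : (fun h : R => - s * ((f x t - f (x - h *: v) t) / h) + e * (C * h)) @ 0^'+ --> (0 : R).
  rewrite -[X in _ --> X]addr0 -[X in _ --> X + _](mulr0 (- s)).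
  apply: cvgD; first exact: cvgMr.
  rewrite -[X in _ --> X](mulr0 e); apply: cvgMr.
  rewrite -[X in _ --> X](mulr0 C); apply: cvgMr.
  by apply: cvg_at_right_filter; exact: cvg_id.
have : e * (2 * L * A) <= 0.
  apply: (cvgr_to_ge lim); near=> h.
  have h0 : 0 < h by near: h; exact: nbhs_right_gt.
  have Oh : Omega (x - h *: v) by near: h; exact: inward_normal_mem.
  have := min _ Oh; rewrite -scaleNr sqdist_line -/A => m.
  rewrite -(ler_pM2r h0) [leRHS]mulrDl -[X in X + _]mulrA divfK ?gt_eqF //.
  rewrite /C; move: m; rewrite sqrrN; lra.
by apply/negP; rewrite -ltNge mulr_gt0.
Unshelve. all: by end_near. Qed.

Lemma touching_laplacian (R : realType) (n : nat) (Omega : set 'rV[R]_n)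
    (f : 'rV[R]_n -> R) (x y : 'rV[R]_n) (s K : R) :
  open Omega -> Omega x ->
  (forall i, (\forall z \near x, derivable f z (evec i)) /\
             derivable (pd i f) x (evec i)) ->
  (forall z, Omega z -> s * f x + K * sqdist x y <= s * f z + K * sqdist z y) ->
  0 <= s * laplacian f x + 2 * K * n%:R.
Proof.
move=> oO Ox df min.
have -> : s * laplacian f x + 2 * K * n%:R = \sum_(i < n) (s * pd i (pd i f) x + K * 2).
  by rewrite big_split /= -mulr_sumr sumr_const card_ord -[(K * 2) *+ n]mulr_natr (mulrC K).
apply: sumr_ge0 => i _; have [df1 df2] := df i.
pose q h := sqdist x y + (2 * (x 0 i - y 0 i)) * h + 1 * h ^+ 2.
pose g h := s * f (x + h *: evec i) + K * q h.
pose g' h := s * pd i f (x + h *: evec i) + K * (2 * (x 0 i - y 0 i) + 2 * 1 * h).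
apply: (@second_derivative_local_min _ g g').
- near=> h; apply: is_derive_lincomb; last exact: is_derive_quadratic.
  apply: is_derive_line.
  by near: h; apply: (@nbhs_line _ _ x (evec i) (fun z => derivable f z (evec i))).
- have E : x + (0 : R) *: evec i = x by rewrite scale0r addr0.
  have D0 : is_derive (0 : R) 1 (fun h : R => pd i f (x + h *: evec i)) (pd i (pd i f) x).
    have H : derivable (pd i f) (x + (0 : R) *: evec i) (evec i) by rewrite E.
    by have := is_derive_line H; rewrite E.
  apply: (is_derive_lincomb s K D0).
  have -> : (fun h : R => 2 * (x 0 i - y 0 i) + 2 * 1 * h) =
     (fun h : R => 2 * (x 0 i - y 0 i) + 2 * h + 0 * h ^+ 2).
    by apply/funext => h; ring.
  by apply: (is_derive_eq (is_derive_quadratic _ _ _ _)); ring.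
- have : \forall h \near (0 : R), Omega (x + h *: evec i).
    by apply: nbhs_line; exact: open_nbhs_nbhs.
  apply: filterS => h /min.
  rewrite /g /q scale0r addr0 sqdist_evec; lra.
Unshelve. all: by end_near. Qed.

Lemma penalty_gradient (R : realType) (n : nat) (rho : 'rV[R]_n -> R) (x y : 'rV[R]_n) (L : R) :
  (forall z, differentiable rho z) ->
  (\forall z \near y, rho y + L * sqdist x y <= rho z + L * sqdist x z) ->
  forall i, pd i rho y = 2 * L * (x 0 i - y 0 i).
Proof.
move=> drho min i.
pose g (h : R) := 1 * rho (y + h *: evec i) +
  L * (sqdist y x + (2 * (y 0 i - x 0 i)) * h + 1 * h ^+ 2).
have dg (h : R) : is_derive h 1 g (1 * pd i rho (y + h *: evec i) +
    L * (2 * (y 0 i - x 0 i) + 2 * 1 * h)).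
  apply: is_derive_lincomb; last exact: is_derive_quadratic.
  by apply: is_derive_line; exact: diff_derivable.
suff : 1 * pd i rho (y + 0 *: evec i) + L * (2 * (y 0 i - x 0 i) + 2 * 1 * 0) = 0.
  rewrite scale0r addr0; lra.
apply: (@is_derive_local_min _ g) => //.
  by near=> h; case: (dg h).
have := @nbhs_line _ _ y (evec i) _ min; apply: filterS => h.
rewrite !(sqdistC x) /g sqdist_evec scale0r addr0; lra.
Unshelve. all: by end_near. Qed.

(** * Comparison principle *)

Lemma compact_sublevel (R : realType) (T : topologicalType) (I : finType) (A : set T)
    (F : I -> T -> R) :
  compact A -> (forall i p, A p -> F i @ within A (nbhs p) --> F i p) ->
  compact [set p | A p /\ exists i, F i p <= 0].
Proof.
move=> cA cF G PG GC.
have GA : G A by apply: filterS GC => p [].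
have [p [Ap clp]] := cA G PG GA.
exists p; split=> //; split=> //; apply: contrapT => Np.
have pos i : 0 < F i p.
  by rewrite ltNge; apply/negP => H; apply: Np; exists i.
have near_pos : \forall q \near p, A q -> forall i, 0 < F i q.
  have : \forall q \near within A (nbhs p), forall i, 0 < F i q.
    by apply: filter_forall => i; exact: (cvgr_gt _ (cF i p Ap)).
  by rewrite near_withinE.
have [q [[Aq [i qi]] /(_ Aq i)]] := clp _ _ GC near_pos.
by rewrite ltNge qi.
Qed.

Lemma cvg_within_comp (T U V : topologicalType) (A : set T) (B : set U) (f : U -> V)
    (g : T -> U) (F : set_system T) (FF : Filter F) (u : U) :
  (forall x, A x -> B (g x)) -> F A -> g @ F --> u ->
  f @ within B (nbhs u) --> f u -> (f \o g) @ F --> f u.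
Proof.
move=> AB FA gF fu W /fu; rewrite nbhs_filterE => BW.
have : \forall x \near F, B (g x) -> W (f (g x)) by exact: (gF _ BW).
by apply: filterS2 FA => x Ax; apply; exact: AB.
Qed.

Definition neumann_regular {R : realType} {n : nat} (Omega : set 'rV[R]_n)
    (rho : 'rV[R]_n -> R) (f : 'rV[R]_n -> R -> R) : Prop :=
  [/\ {within [set p : 'rV[R]_n * R | closure Omega p.1 /\ 0 <= p.2],
        continuous (fun p => f p.1 p.2)},
      C21 Omega f &
      forall x t, rho x = 0 -> 0 < t -> neumann_at rho f x t].

Lemma sqdist_continuous (R : realType) (n : nat) :
  continuous (fun p : 'rV[R]_n * 'rV[R]_n => sqdist p.1 p.2).
Proof.
move=> p; apply: cvg_big => [|i _]; first exact: add_continuous.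
have c : (fun q : 'rV[R]_n * 'rV[R]_n => q.1 0 i - q.2 0 i) @ p --> p.1 0 i - p.2 0 i.
  apply: cvgB.
    by apply: (@cvg_comp _ _ _ fst (fun M : 'rV[R]_n => M 0 i) _ (nbhs p.1)); [exact: cvg_fst|exact: coord_continuous].
  by apply: (@cvg_comp _ _ _ snd (fun M : 'rV[R]_n => M 0 i) _ (nbhs p.2)); [exact: cvg_snd|exact: coord_continuous].
exact: cvgM.
Qed.

(* Doubling the variables stands in for a C^2 function with positive normal
   derivative: minimising over [y] replaces [rho] by its inf-convolution. *)
Definition penalized {R : realType} {n : nat} (rho : 'rV[R]_n -> R) (e L : R)
    (w : 'rV[R]_n -> R -> R) (p : ('rV[R]_n * 'rV[R]_n) * R) : R :=
  w p.1.1 p.2 + e * (rho p.1.2 + L * sqdist p.1.1 p.1.2).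

Lemma penalized_continuous (R : realType) (n : nat) (Omega : set 'rV[R]_n) rho
    (f : 'rV[R]_n -> R -> R) (al : R -> R) (K : set 'rV[R]_n) (s e L t0 t1 : R) (p : ('rV[R]_n * 'rV[R]_n) * R) :
  0 <= t0 -> (forall x, differentiable rho x) -> neumann_regular Omega rho f ->
  continuous al ->
  let A := (closure Omega `*` K) `*` [set t | t0 <= t <= t1] in
  A p ->
  penalized rho e L (fun x t => s * (f x t - al t)) @ within A (nbhs p) -->
  penalized rho e L (fun x t => s * (f x t - al t)) p.
Proof.
move=> t00 drho [cf _ _] cal A Ap.
have crho : continuous rho by move=> x; exact: differentiable_continuous.
have c1 : (fun q : ('rV[R]_n * 'rV[R]_n) * R => q.1.1) @ p --> p.1.1.
  exact: (cvg_comp _ _ (@cvg_fst _ _ (nbhs p.1) (nbhs p.2) _) (@cvg_fst _ _ (nbhs p.1.1) (nbhs p.1.2) _)).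
have c2 : (fun q : ('rV[R]_n * 'rV[R]_n) * R => q.1.2) @ p --> p.1.2.
  exact: (cvg_comp _ _ (@cvg_fst _ _ (nbhs p.1) (nbhs p.2) _) (@cvg_snd _ _ (nbhs p.1.1) (nbhs p.1.2) _)).
have c3 : (fun q : ('rV[R]_n * 'rV[R]_n) * R => q.2) @ p --> p.2.
  exact: (@cvg_snd _ _ (nbhs p.1) (nbhs p.2) _).
apply: cvgD.
  apply: cvgMr; apply: cvgB; last first.
    by apply: cvg_within_filter; apply: (@cvg_comp _ _ _ (fun q : ('rV[R]_n * 'rV[R]_n) * R => q.2) al _ (nbhs p.2)); [exact: c3|exact: cal].
  apply: (@cvg_within_comp _ _ _ A [set q : 'rV[R]_n * R | closure Omega q.1 /\ 0 <= q.2]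
    (fun q => f q.1 q.2) (fun p : ('rV[R]_n * 'rV[R]_n) * R => (p.1.1, p.2)) _ _ (p.1.1, p.2)).
  - by move=> q [[/= q1 _] /andP[q2 _]]; split => //=; exact: le_trans q2.
  - exact: withinT.
  - apply: cvg_within_filter.
    by apply: (@cvg_pair _ _ _ (nbhs p) (nbhs p.1.1) (nbhs p.2)); [exact: c1|exact: c3].
  - apply: (subspace_continuousP _ _).1 cf _ _.
    by case: Ap => [[/= q1 _] /andP[q2 _]]; split => //=; exact: le_trans q2.
apply: cvg_within_filter; apply: cvgMr; apply: cvgD.
  apply: (@cvg_comp _ _ _ (fun q : ('rV[R]_n * 'rV[R]_n) * R => q.1.2) rho _ (nbhs p.1.2)); first exact: c2.
  exact: crho.
apply: cvgMr.
apply: (@cvg_comp _ _ _ (fun p : ('rV[R]_n * 'rV[R]_n) * R => p.1) (fun q => sqdist q.1 q.2) _ (nbhs p.1)).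
  exact: (@cvg_fst _ _ (nbhs p.1) (nbhs p.2) _).
exact: sqdist_continuous.
Qed.

Lemma first_contact (R : realType) (n : nat) (Omega K : set 'rV[R]_n) rho (I : finType)
    (f : I -> 'rV[R]_n -> R -> R) (s : I -> R) (al : I -> R -> R) (t0 t1 e L : R) :
  let Phi i := penalized rho e L (fun x t => s i * (f i x t - al i t)) in
  compact (closure Omega) -> compact K -> (forall x, differentiable rho x) -> 0 <= t0 ->
  (forall i, neumann_regular Omega rho (f i)) -> (forall i, continuous (al i)) ->
  (forall i x y, closure Omega x -> K y -> 0 < Phi i ((x, y), t0)) ->
  (exists i x y t, [/\ closure Omega x, K y, t0 <= t <= t1 & Phi i ((x, y), t) <= 0]) ->
  exists i x y t, [/\ closure Omega x, K y, t0 < t <= t1, Phi i ((x, y), t) = 0 &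
    (forall j x' y', closure Omega x' -> K y' -> 0 <= Phi j ((x', y'), t)) /\
    (forall t', t0 <= t' < t -> 0 < Phi i ((x, y), t'))].
Proof.
move=> Phi cO cK drho t00 reg cal init [i0 [x0 [y0 [t2 [Ox0 Ky0 t2b neg]]]]].
pose A := (closure Omega `*` K) `*` [set t : R | t0 <= t <= t1].
have cA : compact A.
  apply: compact_setX; first exact: compact_setX.
  have -> : [set t : R | t0 <= t <= t1] = `[t0, t1]%classic.
    by apply/seteqP; split => t /=; rewrite in_itv.
  exact: segment_compact.
have cPhi i p : A p -> Phi i @ within A (nbhs p) --> Phi i p.
  by move=> Ap; apply: penalized_continuous.
have cC := compact_sublevel cA cPhi.
set C := [set p | _] in cC.
have C0 : C !=set0 by exists ((x0, y0), t2); split => //; exists i0.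
have csnd : {within C, continuous (fun p : ('rV[R]_n * 'rV[R]_n) * R => p.2)}.
  by apply: continuous_subspaceT => p; exact: cvg_snd.
have [[[x y] t]] := compact_EVT_min C0 cC csnd.
rewrite inE => -[[[/= Ox Ky] tb] [i Phi0]] tmin.
have pos j x' y' t' : closure Omega x' -> K y' -> t0 <= t' < t -> 0 < Phi j ((x', y'), t').
  move=> Ox' Ky' t'b; rewrite ltNge; apply/negP => le0.
  have : t <= t'.
    apply: (tmin ((x', y'), t')); rewrite inE; split; last by exists j.
    by split => //=; lra.
  lra.
have t0t : t0 < t.
  rewrite lt_neqAle; apply/andP; split; last by case/andP: tb.
  by apply/eqP => E; move: Phi0; rewrite -E leNgt init.
have ge0 j x' y' : closure Omega x' -> K y' -> 0 <= Phi j ((x', y'), t).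
  move=> Ox' Ky'.
  have Ap : A ((x', y'), t) by [].
  have lim : (Phi j \o (fun t' => ((x', y'), t'))) @ t^'- --> Phi j ((x', y'), t).
    apply: (@cvg_within_comp _ _ _ [set t' | t0 <= t' <= t1] A) => //.
    - near=> t'; apply/andP; split.
        by near: t'; exact: nbhs_left_ge.
      have : t' < t by near: t'; exact: nbhs_left_lt.
      by move=> /= t't; lra.
    - apply: (@cvg_pair _ _ _ t^'- (nbhs (x', y')) (nbhs t)); first exact: cvg_cst.
      by apply: cvg_at_left_filter; exact: cvg_id.
    - exact: cPhi.
  apply: (cvgr_to_ge lim); near=> t'.
  apply/ltW/pos => //; apply/andP; split.
    by near: t'; exact: nbhs_left_ge.
  by near: t'; exact: nbhs_left_lt.
exists i, x, y, t; split => //.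
- by rewrite t0t; case/andP: tb.
- by apply/eqP; rewrite eq_le Phi0 ge0.
- by split => // t' t'b; exact: pos.
Unshelve. all: by end_near. Qed.

Lemma compact_norm_bounded (R : realType) (T : topologicalType) (A : set T) (g : T -> R) :
  compact A -> {within A, continuous g} ->
  exists2 B : R, 0 < B & forall x, A x -> `|g x| <= B.
Proof.
move=> cA cg; have [A0|/set0P/negP/negPn/eqP ->] := pselect (A !=set0); last first.
  by exists 1.
have cN : {within A, continuous (fun x => `|g x|)}.
  by apply: (@within_continuous_comp _ _ _ A g (fun r : R => `|r|)) => // r _; exact: norm_continuous.
have [x xA max] := compact_EVT_max A0 cA cN.
exists (`|g x| + 1); first by rewrite ltr_wpDl.
by move=> y Ay; apply: le_trans (max y _) _; rewrite ?inE // lerDl.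
Qed.

(* At a first zero of the penalised functions, the gradient of [rho] at [y] is
   [2 * L * (x - y)]: on the boundary this contradicts the Neumann condition, in
   the interior it costs at most [2 * e * L * n] in the Laplacian. *)
Lemma comparison_principle (R : realType) (n : nat) (Omega : set 'rV[R]_n) rho (I : finType)
    (f : I -> 'rV[R]_n -> R -> R) (s d : I -> R) (al al' : I -> R -> R) (t0 t1 eta mu : R) :
  let W i x t := s i * (f i x t - al i t) in
  open Omega -> bounded_set Omega -> C1_defining_function Omega rho ->
  0 <= t0 -> 0 < eta -> 0 < mu -> (forall i, 0 <= d i) ->
  (forall i, neumann_regular Omega rho (f i)) ->
  (forall i (t : R), is_derive t 1 (al i) (al' i t)) ->
  (forall i x, closure Omega x -> eta <= W i x t0) ->
  (forall i x t, Omega x -> t0 < t <= t1 -> (forall j, - eta <= W j x t) ->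
     `|W i x t| <= eta ->
     mu <= s i * ('D_1 (f i x) t - d i * laplacian (f i ^~ t) x - al' i t)) ->
  forall i x t, closure Omega x -> t0 <= t <= t1 -> 0 <= W i x t.
Proof.
move=> W oO bO Crho t00 eta0 mu0 d0 reg dal init reac.
have [drho [_ [OE [cl _]]]] := Crho.
have crho : continuous rho by move=> x; exact: differentiable_continuous.
have cal i : continuous (al i).
  move=> t; apply: differentiable_continuous; apply/derivable1_diffP.
  by case: (dal i t).
have [r r0 Hr] := normals_stable bO Crho.
have [M M0 HM] := closure_normr_le bO.
pose K := [set y : 'rV[R]_n | `|y| <= M + 1].
have cK : compact K := @compact_normr_le R n (M + 1).
have OK x : closure Omega x -> K x by move=> /HM xM; rewrite /K /=; lra.
have [B B0 HB] := compact_norm_bounded cK (continuous_subspaceT crho).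
pose r' := Num.min r 1.
have r'0 : 0 < r' by rewrite lt_min r0 ltr01.
pose L := 2 * B / r' ^+ 2 + 1.
have rr0 : 0 < r' ^+ 2 by rewrite exprn_gt0.
have L0 : 0 < L by rewrite ltr_wpDl // divr_ge0 ?mulr_ge0 // ltW.
have HL : 2 * B < L * r' ^+ 2.
  by rewrite /L [ltRHS]mulrDl divfK ?gt_eqF // mul1r ltrDl.
pose D := 2 * L * n%:R * \sum_i d i.
have D0 : 0 <= D.
  by apply: mulr_ge0; [rewrite !mulr_ge0 // ltW|apply: sumr_ge0].
suff pert (e : R) : 0 < e -> e * B < eta -> e * D < mu ->
    forall i x t, closure Omega x -> t0 <= t <= t1 -> 0 < W i x t + e * rho x.
  move=> i x t Ox tb; rewrite leNgt; apply/negP => W0.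
  pose e := Num.min (Num.min (eta / (2 * B)) (mu / (2 * (D + 1)))) (- W i x t / B).
  have D1 : 0 < D + 1 by rewrite ltr_wpDl.
  have e0 : 0 < e by rewrite !lt_min !divr_gt0 ?mulr_gt0 // oppr_gt0.
  have e1 : e * (2 * B) <= eta by rewrite -ler_pdivlMr ?mulr_gt0 // !ge_min lexx.
  have e2 : e * (2 * (D + 1)) <= mu by rewrite -ler_pdivlMr ?mulr_gt0 // !ge_min lexx orbT.
  have e3 : e * B <= - W i x t by rewrite -ler_pdivlMr // !ge_min lexx orbT.
  have eB : 0 < e * B by rewrite mulr_gt0.
  have eD : 0 <= e * D by rewrite mulr_ge0 // ltW.
  have := pert e e0 _ _ i x t Ox tb.
  have -> : e * B < eta by lra.
  have -> : e * D < mu by lra.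
  move=> /(_ isT isT).
  have : e * rho x <= e * B.
    by rewrite ler_pM2l //; apply: le_trans (ler_norm _) (HB _ (OK _ Ox)).
  lra.
move=> e0 eB eD i x t Ox tb; rewrite ltNge; apply/negP => neg.
have rhoB y : K y -> - (e * B) <= e * rho y <= e * B.
  move=> /HB; rewrite ler_norml => /andP[H1 H2].
  by rewrite -mulrN !ler_pM2l // H1 H2.
have [||i1 [x1 [y1 [t2 [Ox1 Ky1 t2b Phi0 [ge0 gt0]]]]]] :=
    @first_contact R n Omega K rho I f s al t0 t1 e L (compact_closure bO) cK drho t00 reg cal.
- move=> j z y Oz Ky; rewrite /penalized /=.
  have := init j z Oz; rewrite /W.
  have : 0 <= e * (L * sqdist z y) by rewrite !mulr_ge0 ?sqdist_ge0 // ltW.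
  by have := rhoB y Ky; lra.
- by exists i, x, x, t; split => //; [exact: OK|rewrite /penalized /= sqdistxx mulr0 addr0].
rewrite /penalized /= in Phi0 ge0 gt0.
have ymin z : K z -> rho y1 + L * sqdist x1 y1 <= rho z + L * sqdist x1 z.
  move=> Kz; have := ge0 i1 x1 z Ox1 Kz; rewrite -Phi0 lerD2l.
  by rewrite ler_pM2l.
have xy : ball x1 r' y1.
  apply: sqdist_ball => //; rewrite -(ltr_pM2l L0); apply: le_lt_trans HL.
  have := ymin x1 (OK _ Ox1); rewrite sqdistxx mulr0 addr0.
  have := HB _ Ky1; have := HB _ (OK _ Ox1); rewrite !ler_norml; lra.
have gy : forall k, pd k rho y1 = 2 * L * (x1 0 k - y1 0 k).
  apply: penalty_gradient => //.
  have yM : `|y1| < M + 1.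
    have : ball x1 1 y1 by apply: le_ball xy; rewrite ge_min lexx orbT.
    rewrite -ball_normE /= => xy1.
    have := HM _ Ox1; have := lerB_dist y1 x1; rewrite distrC; lra.
  have : \forall z \near y1, `|z| < M + 1.
    by have := cvgr_lt _ (@norm_continuous _ _ y1) _ yM; exact.
  by apply: filterS => z zM; apply: ymin; exact: ltW.
have t20 : 0 < t2 by lra.
have xmin z : closure Omega z -> s i1 * f i1 x1 t2 + e * (L * sqdist x1 y1) <=
    s i1 * f i1 z t2 + e * (L * sqdist z y1).
  by move=> Oz; have := ge0 i1 z y1 Oz Ky1; rewrite -Phi0; lra.
have [_ [C21t _] Nf] := reg i1.
have [rx|rx] := eqVneq (rho x1) 0.
  apply: (no_touching_at_boundary Crho rx (Nf _ _ rx t20) e0 gy).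
    by apply: Hr => //; apply: le_ball xy; rewrite ge_min lexx.
  by move=> z Oz; apply: xmin; exact: subset_closure.
have Oi : Omega x1.
  by move: Ox1; rewrite cl OE /= lt_neqAle rx.
have [dft dfx] := C21t _ _ Oi t20.
have lap : 0 <= s i1 * laplacian (f i1 ^~ t2) x1 + 2 * (e * L) * n%:R.
  apply: (@touching_laplacian _ _ Omega (f i1 ^~ t2) x1 y1) => //.
    by move=> k; have [H1 H2] := dfx k; split => //; exact: H2.
  by move=> z Oz; rewrite -!mulrA; apply: xmin; exact: subset_closure.
have time : s i1 * ('D_1 (f i1 x1) t2 - al' i1 t2) <= 0.
  apply: (@derivative_left_min _ (fun t => s i1 * f i1 x1 t + (- s i1) * al i1 t) t2 _ (t2 - t0)).
  - lra.
  - have -> : s i1 * ('D_1 (f i1 x1) t2 - al' i1 t2) =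
      s i1 * 'D_1 (f i1 x1) t2 + (- s i1) * al' i1 t2 by ring.
    by apply: is_derive_lincomb => //; exact: DeriveDef.
  - by move=> t' t'b; have := gt0 t'; rewrite -Phi0 => /(_ _)/ltW; lra.
have Wge j : - eta <= W j x1 t2.
  have := ge0 j x1 x1 Ox1 (OK _ Ox1); rewrite sqdistxx mulr0 addr0 -/(W j x1 t2).
  have := rhoB _ (OK _ Ox1); lra.
have := reac i1 x1 t2 Oi t2b Wge.
have -> : `|W i1 x1 t2| <= eta.
  rewrite ler_norml Wge /=.
  have : 0 <= e * (L * sqdist x1 y1) by rewrite !mulr_ge0 ?sqdist_ge0 // ltW.
  have := rhoB _ Ky1; rewrite /W; lra.
move=> /(_ isT).
have : d i1 * (- (s i1 * laplacian (f i1 ^~ t2) x1)) <= d i1 * (2 * (e * L) * n%:R).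
  by apply: ler_wpM2l => //; lra.
have : d i1 * (2 * (e * L) * n%:R) <= e * D.
  have -> : e * D = (\sum_j d j) * (2 * (e * L) * n%:R) by rewrite /D; ring.
  apply: ler_wpM2r; first by rewrite !mulr_ge0 // ltW.
  by rewrite (bigD1 i1) //= lerDl sumr_ge0.
lra.
Qed.

(** * Barriers *)

Definition barrier {R : realType} (A B r t0 t : R) : R := A + B * expR (- r * (t - t0)).

Lemma is_derive_barrier (R : realType) (A B r t0 t : R) :
  is_derive t 1 (barrier A B r t0) (- r * (B * expR (- r * (t - t0)))).
Proof.
have H1 : is_derive t 1 (fun t : R => - r * (t - t0)) (- r).
  have := is_derive_quadratic (r * t0) (- r) 0 t.
  have -> : (fun h : R => r * t0 + - r * h + 0 * h ^+ 2) = (fun t => - r * (t - t0)).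
    by apply/funext => h; ring.
  by rewrite mulr0 mul0r addr0.
have H2 := @is_derive1_comp _ expR (fun t : R => - r * (t - t0)) t _ _ (is_derive_expR _) H1.
have H3 := is_derive_lincomb A B (is_derive_cst (1 : R) t 1) H2.
have E : (fun h : R => A * cst 1 h + B * (expR \o (fun t => - r * (t - t0))) h) = barrier A B r t0.
  by apply/funext => h; rewrite /barrier /= mulr1.
rewrite -E; apply: (is_derive_eq H3); ring.
Qed.

Lemma expR_decay (R : realType) (r t0 t : R) : 0 <= r -> t0 <= t ->
  0 < expR (- r * (t - t0)) <= 1.
Proof.
move=> r0 tt0; rewrite expR_gt0 /= -expR0 ler_expR.
by rewrite mulNr oppr_le0 mulr_ge0 // subr_ge0.
Qed.

Lemma expR_eventually_small (R : realType) (r C t0 e : R) : 0 < r -> 0 < C -> 0 < e ->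
  exists2 T, t0 <= T & forall t, T <= t -> C * expR (- r * (t - t0)) <= e.
Proof.
move=> r0 C0 e0; exists (t0 + C / e / r); first by rewrite lerDl !divr_ge0 // ltW.
move=> t; rewrite -lerBrDl ler_pdivrMr // mulrC => H.
rewrite mulNr expRN ler_pdivrMr ?expR_gt0 // -ler_pdivrMl // mulrC.
apply: le_trans (expR_ge1Dx _); lra.
Qed.

Lemma linear_positivity (R : realType) (n : nat) (Omega : set 'rV[R]_n) rho
    (f : 'rV[R]_n -> R -> R) (d c T P : R) :
  open Omega -> bounded_set Omega -> C1_defining_function Omega rho ->
  neumann_regular Omega rho f -> 0 <= d -> 0 < c -> 0 <= P ->
  (forall x, closure Omega x -> f x 0 = c) ->
  (forall x t, Omega x -> 0 < t <= T -> exists2 p, `|p| <= P &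
     'D_1 (f x) t - d * laplacian (f ^~ t) x = p * f x t) ->
  exists2 m, 0 < m & forall x t, closure Omega x -> 0 <= t <= T -> m <= f x t.
Proof.
move=> oO bO Crho reg d0 c0 P0 init reac.
have [T0|T0] := ltP T 0.
  by exists 1 => // x t _; lra.
pose r := P + 1.
pose E := expR (- r * (T - 0)).
have E0 : 0 < E by exact: expR_gt0.
have cE : 0 < c / 2 * E by rewrite !mulr_gt0.
have r0 : 0 < r by rewrite /r; lra.
have Emin t : 0 <= t <= T -> c / 2 * E <= c / 2 * expR (- r * (t - 0)).
  move=> tb; rewrite ler_pM2l ?divr_gt0 // ler_expR ler_nM2l ?oppr_lt0 //; lra.
exists (c / 2 * E) => // x t Ox tb.
pose eta := Num.min (c / 2) (c / 2 * E / (2 * r)).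
have eta0 : 0 < eta by rewrite lt_min !divr_gt0 //= mulr_gt0.
have eta1 : eta <= c / 2 by rewrite ge_min lexx.
have eta2 : eta * (2 * r) <= c / 2 * E.
  by rewrite -ler_pdivlMr ?mulr_gt0 // ge_min lexx orbT.
have := @comparison_principle R n Omega rho unit (fun=> f) (fun=> 1) (fun=> d)
  (fun=> barrier 0 (c / 2) r 0) (fun _ t => - r * (c / 2 * expR (- r * (t - 0))))
  0 T eta (c / 2 * E / 2) oO bO Crho (lexx 0) eta0.
move=> /(_ _ _ _ _ _ _ tt x t Ox tb) H.
have : 0 <= 1 * (f x t - barrier 0 (c / 2) r 0 t).
  apply: H => //.
  - by rewrite divr_gt0.
  - by move=> _ s; exact: is_derive_barrier.
  - by move=> _ z Oz; rewrite init // /barrier subr0 mulr0 expR0; lra.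
  - move=> _ z s Oz sb _; rewrite /barrier !mul1r add0r ler_norml => Wb.
    have [p pP ->] := reac z s Oz sb.
    set b := c / 2 * expR _ in Wb *.
    have bE : c / 2 * E <= b by apply: Emin; lra.
    have pf : - (P * (b + eta)) <= p * f z s.
      have : `|p * f z s| <= P * (b + eta).
        rewrite normrM; apply: ler_pM => //.
        by rewrite ler_norml; lra.
      by rewrite ler_norml => /andP[].
    by rewrite /r in eta2 *; lra.
rewrite /barrier add0r mul1r subr_ge0; exact: le_trans (Emin _ tb).
Qed.

Lemma eventual_upper_bound (R : realType) (n : nat) (Omega : set 'rV[R]_n) rho
    (f : 'rV[R]_n -> R -> R) (d t0 l l' ka : R) :
  open Omega -> bounded_set Omega -> C1_defining_function Omega rho ->
  neumann_regular Omega rho f -> 0 <= d -> 0 <= t0 -> l < l' -> 0 < ka ->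
  (exists B, forall x, closure Omega x -> f x t0 <= B) ->
  (forall x t, Omega x -> t0 < t -> l <= f x t ->
     'D_1 (f x) t - d * laplacian (f ^~ t) x <= - ka) ->
  exists2 T, t0 <= T & forall x t, closure Omega x -> T <= t -> f x t <= l'.
Proof.
move=> oO bO Crho reg d0 t00 ll' ka0 [B HB] reac.
pose A := (l + l') / 2.
pose C : R := `|B| + `|A| + 1.
have C0 : 0 < C by rewrite /C ltr_wpDl // addr_ge0.
pose r := ka / (2 * C).
have r0 : 0 < r by rewrite divr_gt0 // mulr_gt0.
have rC : r * C = ka / 2.
  by rewrite /r; field; lra.
have e0 : 0 < l' - A by rewrite /A; lra.
have [T t0T HT] := expR_eventually_small t0 r0 C0 e0.
exists T => // x t Ox tT.
pose eta := Num.min 1 (A - l).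
have eta0 : 0 < eta by rewrite lt_min ltr01 /A; lra.
have eta1 : eta <= 1 by rewrite ge_min lexx.
have eta2 : eta <= A - l by rewrite ge_min lexx orbT.
have tb : t0 <= t <= t by lra.
have := @comparison_principle R n Omega rho unit (fun=> f) (fun=> -1) (fun=> d)
  (fun=> barrier A C r t0) (fun _ t => - r * (C * expR (- r * (t - t0))))
  t0 t eta (ka / 2) oO bO Crho t00 eta0.
move=> /(_ _ _ _ _ _ _ tt x t Ox tb) H.
have : 0 <= -1 * (f x t - barrier A C r t0 t).
  apply: H => //.
  - by rewrite divr_gt0.
  - by move=> _ s; exact: is_derive_barrier.
  - move=> _ z Oz; rewrite /barrier subrr mulr0 expR0 mulr1.
    have := HB z Oz; have := ler_norm B; have := ler_norm (- A); rewrite normrN /C; lra.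
  - move=> _ z s Oz sb _; rewrite ler_norml /barrier => Wb.
    have ts : t0 <= s by lra.
    have /andP[E0 E1] := expR_decay (ltW r0) ts.
    have ts' : t0 < s by lra.
    have CE : 0 <= C * expR (- r * (s - t0)) by rewrite mulr_ge0 // ltW.
    have lf : l <= f z s by lra.
    have := reac z s Oz ts' lf.
    have : r * (C * expR (- r * (s - t0))) <= r * (C * 1).
      by rewrite !ler_pM2l.
    rewrite mulr1 rC; lra.
by have := HT t tT; rewrite /barrier; clear H; lra.
Qed.

Lemma segment_ge (R : realFieldType) (p0 p1 k E : R) :
  0 <= E <= 1 -> k <= p0 -> k <= p1 -> k <= p1 + (p0 - p1) * E.
Proof.
move=> /andP[E0 E1] k0 k1.
have h0 : 0 <= (p0 - k) * E by rewrite mulr_ge0 ?subr_ge0.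
have h1 : 0 <= (p1 - k) * (1 - E) by rewrite mulr_ge0 ?subr_ge0.
by lra.
Qed.

Lemma perturbed_margin (R : realFieldType) (K B C x y x' y' eta k : R) :
  0 < B -> 0 < C -> eta * (2 * (B + C)) <= k -> k <= K - B * x - C * y ->
  x' <= x + eta -> y' <= y + eta -> k / 2 <= K - B * x' - C * y'.
Proof.
move=> B0 C0 ek kK xx yy.
have h1 : B * x' <= B * (x + eta) by rewrite ler_pM2l.
have h2 : C * y' <= C * (y + eta) by rewrite ler_pM2l.
by lra.
Qed.

(* Along the segment from [(al0, be0)] to [(al1, be1)] the kinetic vector field of
   the Lotka-Volterra system points into the rectangles [u >= al, v <= be], so
   these rectangles may shrink slowly. *)
Lemma shrinking_rectangles (R : realType) (n : nat) (Omega : set 'rV[R]_n) rho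
    (u v : 'rV[R]_n -> R -> R) (a1 a2 b1 b2 c1 c2 d1 d2 t0 al0 al1 be0 be1 ka e : R) :
  open Omega -> bounded_set Omega -> C1_defining_function Omega rho ->
  neumann_regular Omega rho u -> neumann_regular Omega rho v ->
  0 < b1 -> 0 < b2 -> 0 < c1 -> 0 < c2 ->
  0 <= d1 -> 0 <= d2 -> 0 <= t0 -> 0 < ka -> 0 < e ->
  0 < al0 <= al1 -> 0 < be1 <= be0 ->
  ka <= a1 - b1 * al0 - c1 * be0 -> ka <= a1 - b1 * al1 - c1 * be1 ->
  ka <= b2 * be0 + c2 * al0 - a2 -> ka <= b2 * be1 + c2 * al1 - a2 ->
  (forall x t, Omega x -> t0 < t -> 0 <= u x t -> 0 <= v x t ->
     u x t * (a1 - b1 * u x t - c1 * v x t) <= 'D_1 (u x) t - d1 * laplacian (u ^~ t) x) ->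
  (forall x t, Omega x -> t0 < t -> 0 <= u x t -> 0 <= v x t ->
     'D_1 (v x) t - d2 * laplacian (v ^~ t) x <= v x t * (a2 - b2 * v x t - c2 * u x t)) ->
  (forall x t, Omega x -> t0 < t -> 0 <= u x t /\ 0 <= v x t) ->
  (exists2 eta, 0 < eta & forall x, closure Omega x -> al0 + eta <= u x t0 /\ v x t0 <= be0 - eta) ->
  exists2 T, t0 <= T & forall x t, closure Omega x -> T <= t -> al1 - e <= u x t /\ v x t <= be1 + e.
Proof.
move=> oO bO Crho regu regv b10 b20 c10 c20 d10 d20 t00 ka0 e0 /andP[al00 al01] /andP[be10 be01].
move=> k1 k2 k3 k4 hu hv nn [eta1 eta10 init].
pose C := (al1 - al0) + (be0 - be1) + 1.
have C0 : 0 < C by rewrite /C; lra.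
pose S := b1 + b2 + c1 + c2.
have S0 : 0 < S by rewrite /S; lra.
pose m := Num.min al0 be1.
have m0 : 0 < m by rewrite lt_min al00 be10.
have m1 : m <= al0 by rewrite ge_min lexx.
have m2 : m <= be1 by rewrite ge_min lexx orbT.
pose eta := Num.min eta1 (Num.min (m / 2) (ka / (2 * S))).
have eta0 : 0 < eta by rewrite !lt_min eta10 !divr_gt0 // mulr_gt0.
have eta2 : eta <= eta1 by rewrite ge_min lexx.
have eta3 : eta <= m / 2 by rewrite !ge_min lexx orbT.
have eta4 : eta * (2 * S) <= ka.
  by rewrite -ler_pdivlMr ?mulr_gt0 // !ge_min lexx !orbT.
have etaS1 : eta * (2 * (b1 + c1)) <= ka.
  by apply: le_trans eta4; rewrite ler_pM2l // ler_pM2l // /S; clear -b20 c20; lra.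
have etaS2 : eta * (2 * (b2 + c2)) <= ka.
  by apply: le_trans eta4; rewrite ler_pM2l // ler_pM2l // /S; clear -b10 c10; lra.
pose mu := m / 2 * (ka / 2).
have mu0 : 0 < mu by rewrite mulr_gt0 // divr_gt0.
pose r := mu / (2 * C).
have r0 : 0 < r by rewrite divr_gt0 // mulr_gt0.
have rC : r * C = mu / 2 by rewrite /r; field; lra.
have [T t0T HT] := expR_eventually_small t0 r0 C0 e0.
exists T => // x t Ox tT.
have tb : t0 <= t <= t by lra.
pose W := fun (i : bool) (x : 'rV[R]_n) (t : R) =>
  (if i then 1 else -1) * ((if i then u else v) x t -
    (if i then barrier al1 (al0 - al1) r t0 else barrier be1 (be0 - be1) r t0) t).
have Wu y s : W true y s = u y s - barrier al1 (al0 - al1) r t0 s by rewrite /W mul1r.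
have Wv y s : W false y s = barrier be1 (be0 - be1) r t0 s - v y s by rewrite /W mulN1r opprB.
have H : forall i, 0 <= W i x t.
  move=> i; move: i x t Ox tb {tT}.
  move=> i x t Ox tb.
  apply: (@comparison_principle R n Omega rho bool (fun i => if i then u else v)
    (fun i => if i then 1 else -1) (fun i => if i then d1 else d2)
    (fun i => if i then barrier al1 (al0 - al1) r t0 else barrier be1 (be0 - be1) r t0)
    (fun i s => - r * ((if i then al0 - al1 else be0 - be1) * expR (- r * (s - t0))))
    t0 t eta (mu / 2)) => //.
  - by rewrite divr_gt0.
  - by case.
  - by case.
  - by case => s; exact: is_derive_barrier.
  - move=> j z Oz; have [iu iv] := init z Oz.
    rewrite -/(W j z t0); case: j; rewrite ?Wu ?Wv /barrier subrr mulr0 expR0;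
      by clear -iu iv eta2; lra.
  - move=> j z s Oz sb WW; rewrite -/(W j z s) => Wj.
    have := WW true; rewrite -/(W true z s) => W1.
    have := WW false; rewrite -/(W false z s) => W2.
    clear WW.
    have ts : t0 < s by lra.
    have [u0 v0] := nn z s Oz ts.
    have := hu z s Oz ts u0 v0; have := hv z s Oz ts u0 v0.
    have /andP[E0 E1] := expR_decay (ltW r0) (ltW ts).
    have E01 : 0 <= expR (- r * (s - t0)) <= 1 by rewrite ltW.
    move: Wj W1 W2; rewrite Wu Wv /barrier => Wj W1 W2 Hv Hu.
    set E := expR _ in E0 E1 E01 Wj W1 W2 *.
    have rEC : r * (C * E) <= mu / 2.
      by rewrite mulrA rC ler_piMr // divr_ge0 // ltW.
    have q1 : r * ((al1 - al0) * E) <= mu / 2.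
      apply: le_trans rEC; rewrite ler_pM2l // ler_pM2r // /C.
      by clear -be01; lra.
    have q2 : r * ((be0 - be1) * E) <= mu / 2.
      apply: le_trans rEC; rewrite ler_pM2l // ler_pM2r // /C.
      by clear -al01; lra.
    have conv1 : ka <= a1 - b1 * (al1 + (al0 - al1) * E) - c1 * (be1 + (be0 - be1) * E).
      by have := segment_ge E01 k1 k2; congr (_ <= _); ring.
    have conv2 : ka <= - a2 - b2 * - (be1 + (be0 - be1) * E) - c2 * - (al1 + (al0 - al1) * E).
      by have := segment_ge E01 k3 k4; congr (_ <= _); ring.
    have aa0 : al0 <= al1 + (al0 - al1) * E by apply: segment_ge.
    have bb1 : be1 <= be1 + (be0 - be1) * E by apply: segment_ge.
    set a := al1 + _ in conv1 conv2 aa0 W1 W2.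
    set b := be1 + _ in conv1 conv2 bb1 W1 W2.
    case: j Wj => Wj.
      have {}Wj : `|u z s - a| <= eta by move: Wj; rewrite Wu.
      have f3 : mu <= u z s * (a1 - b1 * u z s - c1 * v z s).
        apply: ler_pM; rewrite ?divr_ge0 ?(ltW m0) ?(ltW ka0) //.
          by clear -W1 aa0 m1 eta3; lra.
        apply: (perturbed_margin b10 c10 etaS1 conv1).
          by rewrite -lerBlDl; exact: le_trans (ler_norm _) Wj.
        by clear -W2; lra.
      by clear -f3 Hu q1; lra.
    have {}Wj : `|b - v z s| <= eta by move: Wj; rewrite Wv.
    have wv : b - eta <= v z s by move: (le_trans (ler_norm _) Wj); clear; lra.
    have f3 : mu <= v z s * (- a2 - b2 * - v z s - c2 * - u z s).
      apply: ler_pM; rewrite ?divr_ge0 ?(ltW m0) ?(ltW ka0) //.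
        by clear -wv bb1 m2 eta3; lra.
      by apply: (perturbed_margin b20 c20 etaS2 conv2); [clear -wv; lra|clear -W1; lra].
    by clear -f3 Hv q2; lra.
have H1 := H true; have H2 := H false; clear H.
rewrite Wu /barrier in H1; rewrite Wv /barrier in H2.
have := HT t tT; set E := expR _ in H1 H2 * => HE.
have E0 : 0 < E by exact: expR_gt0.
have p1 : 0 <= (al1 - al0) * E by rewrite mulr_ge0 ?subr_ge0 // ltW.
have p2 : 0 <= (be0 - be1) * E by rewrite mulr_ge0 ?subr_ge0 // ltW.
have E1 : 0 <= 1 * E by rewrite mul1r ltW.
move: HE; rewrite /C !(mulrDl _ _ E) => HE.
by split; clear -H1 H2 HE p1 p2 E1; lra.
Qed.

Lemma corner_choice (R : realFieldType) (a1 a2 b1 b2 c1 c2 be0 m e : R) :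
  0 < a1 -> 0 < a2 -> 0 < b1 -> 0 < b2 -> 0 < c1 -> 0 < c2 -> 0 < m -> 0 < e ->
  0 < be0 -> c1 * be0 < a1 -> a2 < b2 * be0 -> a2 * b1 < a1 * c2 ->
  exists al0 al1 be1 ka,
    [/\ 0 < al0 <= al1, 0 < be1 <= be0, 0 < ka, al0 < m & a1 / b1 - e <= al1] /\
    [/\ be1 <= e, ka <= a1 - b1 * al0 - c1 * be0, ka <= a1 - b1 * al1 - c1 * be1,
        ka <= b2 * be0 + c2 * al0 - a2 & ka <= b2 * be1 + c2 * al1 - a2].
Proof.
move=> a10 a20 b10 b20 c10 c20 m0 e0 be00 h1 h2 h3.
pose h := a1 / b1 - a2 / c2.
have h0 : 0 < h by rewrite subr_gt0 ltr_pdivrMr // mulrAC ltr_pdivlMr.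
pose e' := Num.min e (h / 2).
have e'0 : 0 < e' by rewrite lt_min e0 divr_gt0.
have e'e : e' <= e by rewrite ge_min lexx.
have e'h : e' <= h / 2 by rewrite ge_min lexx orbT.
have a2c2 : 0 < a2 / c2 by rewrite divr_gt0.
pose al1 := a1 / b1 - e'.
have al10 : 0 < al1 by rewrite /al1; move: e'h; rewrite /h; clear -a2c2 h0; rewrite /h in h0; lra.
have bal1 : b1 * al1 = a1 - b1 * e' by rewrite /al1; field; rewrite gt_eqF.
have cal1 : c2 * al1 - a2 = c2 * (h - e') by rewrite /al1 /h; field; rewrite !gt_eqF.
pose be1 := Num.min (Num.min e be0) (b1 * e' / (2 * c1)).
have be10 : 0 < be1 by rewrite !lt_min e0 be00 divr_gt0 // mulr_gt0.
have be1e : be1 <= e by rewrite !ge_min lexx.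
have be1b : be1 <= be0 by rewrite !ge_min lexx orbT.
have be1c : be1 * (2 * c1) <= b1 * e'.
  by rewrite -ler_pdivlMr ?mulr_gt0 // !ge_min lexx orbT.
pose al0 := Num.min (Num.min (m / 2) al1) ((a1 - c1 * be0) / (2 * b1)).
have al00 : 0 < al0 by rewrite !lt_min al10 !divr_gt0 ?mulr_gt0 // subr_gt0.
have al0m : al0 <= m / 2 by rewrite !ge_min lexx.
have al01 : al0 <= al1 by rewrite !ge_min lexx orbT.
have al0b : al0 * (2 * b1) <= a1 - c1 * be0.
  by rewrite -ler_pdivlMr ?mulr_gt0 // !ge_min lexx orbT.
pose ka := Num.min (Num.min ((a1 - c1 * be0) / 2) (b1 * e' / 2))
  (Num.min (b2 * be0 - a2) (c2 * (h / 2))).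
have ka1 : ka <= (a1 - c1 * be0) / 2 by rewrite !ge_min lexx.
have ka2 : ka <= b1 * e' / 2 by rewrite !ge_min lexx !orbT.
have ka3 : ka <= b2 * be0 - a2 by rewrite !ge_min lexx !orbT.
have ka4 : ka <= c2 * (h / 2) by rewrite !ge_min lexx !orbT.
have ka0 : 0 < ka.
  rewrite !lt_min; apply/andP; split; apply/andP; split.
  - by rewrite divr_gt0 // subr_gt0.
  - by rewrite divr_gt0 // mulr_gt0.
  - by rewrite subr_gt0.
  - by rewrite mulr_gt0 // divr_gt0.
exists al0, al1, be1, ka; split; split.
- by rewrite al00.
- by rewrite be10.
- by [].
- by clear -al0m m0; lra.
- by rewrite /al1 lerB.
- by [].
- by clear -ka1 al0b; lra.
- by rewrite bal1; clear -ka2 be1c; lra.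
- have : 0 < c2 * al0 by rewrite mulr_gt0.
  by clear -ka3; lra.
- have : 0 < b2 * be1 by rewrite mulr_gt0.
  have : c2 * (h / 2) <= c2 * (h - e') by rewrite ler_pM2l //; clear -e'h; lra.
  by rewrite -cal1; clear -ka4; lra.
Qed.

Lemma neumann_regular_bounded (R : realType) (n : nat) (Omega : set 'rV[R]_n) rho
    (f : 'rV[R]_n -> R -> R) (T : R) :
  bounded_set Omega -> neumann_regular Omega rho f ->
  exists2 B, 0 < B & forall x t, closure Omega x -> 0 <= t <= T -> `|f x t| <= B.
Proof.
move=> bO [cf _ _].
pose A := closure Omega `*` [set t : R | 0 <= t <= T].
have cA : compact A.
  apply: compact_setX; first exact: compact_closure.
  have -> : [set t : R | 0 <= t <= T] = `[0, T]%classic.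
    by apply/seteqP; split => t /=; rewrite in_itv.
  exact: segment_compact.
have cfA : {within A, continuous (fun p => f p.1 p.2)}.
  by apply: continuous_subspaceW cf => p [Op /andP[p0 _]].
have [B B0 HB] := compact_norm_bounded cA cfA.
by exists B => // x t Ox tb; exact: (HB (x, t)).
Qed.

Lemma logistic_decay (R : realFieldType) (a b l w : R) : 0 < a -> 0 < b -> a / b < l -> l <= w ->
  w * (a - b * w) <= - (l * (b * l - a)).
Proof.
move=> a0 b0 abl lw.
have l0 : 0 < l by apply: lt_trans abl; rewrite divr_gt0.
have bl : 0 < b * l - a by rewrite subr_gt0 mulrC -ltr_pdivrMr.
have bw : b * l <= b * w by rewrite ler_pM2l.
have : l * (b * l - a) <= w * (b * w - a).
  by apply: ler_pM => //; [exact: ltW|exact: ltW|exact: lerB].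
by clear; lra.
Qed.

Lemma solution_regular (R : realType) (n : nat) (Omega : set 'rV[R]_n) rho k
    (a1 a2 b1 b2 c1 c2 d1 d2 c d : R) u v :
  is_solution Omega rho k a1 a2 b1 b2 c1 c2 d1 d2 c d u v ->
  neumann_regular Omega rho u /\ neumann_regular Omega rho v.
Proof.
move=> [cu [cv [Cu [Cv [_ [_ [N _]]]]]]].
by split; split => // x t rx t0; have [] := N x t rx t0.
Qed.

Lemma solution_positive (R : realType) (n : nat) (Omega : set 'rV[R]_n) rho k
    (a1 a2 b1 b2 c1 c2 d1 d2 c d T : R) u v :
  open Omega -> bounded_set Omega -> C1_defining_function Omega rho ->
  (forall x, closure Omega x -> 0 <= k x) ->
  0 < a1 -> 0 < a2 -> 0 < b1 -> 0 < b2 -> 0 < c1 -> 0 < c2 -> 0 < d1 -> 0 < d2 ->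
  0 < c -> 0 < d ->
  is_solution Omega rho k a1 a2 b1 b2 c1 c2 d1 d2 c d u v ->
  exists2 m, 0 < m & forall x t, closure Omega x -> 0 <= t <= T -> m <= u x t /\ m <= v x t.
Proof.
move=> oO bO Crho k0 a10 a20 b10 b20 c10 c20 d10 d20 c0 d0 sol.
have [regu regv] := solution_regular sol.
have [_ [_ [_ [_ [equ [eqv [_ init]]]]]]] := sol.
have [Bu Bu0 HBu] := neumann_regular_bounded T bO regu.
have [Bv Bv0 HBv] := neumann_regular_bounded T bO regv.
have bound (z p q x y : R) : 0 < p -> 0 < q -> `|z| <= x -> `|y| <= Bu -> forall w, `|w| <= Bv ->
    `|z - p * w - q * y| <= x + p * Bv + q * Bu.
  move=> p0 q0 zx yB w wB.
  apply: le_trans (ler_normB _ _) _; apply: lerD.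
    apply: le_trans (ler_normB _ _) _; apply: lerD => //.
    by rewrite normrM gtr0_norm // ler_pM2l.
  by rewrite normrM gtr0_norm // ler_pM2l.
have [|x Ox|x t Ox tb|mu mu0 Hu] := @linear_positivity R n Omega rho u d1 c T (a1 + c1 * Bv + b1 * Bu)
    oO bO Crho regu (ltW d10) c0.
- by rewrite !addr_ge0 // ?mulr_ge0 // ltW.
- by have [] := init x Ox.
- have Oc : closure Omega x by exact: subset_closure.
  have tb' : 0 <= t <= T by clear -tb; lra.
  exists (a1 - c1 * v x t - b1 * u x t).
    by apply: bound => //; [rewrite gtr0_norm|exact: HBu|exact: HBv].
  by rewrite equ //; [ring|case/andP: tb].
have [|x Ox|x t Ox tb|mv mv0 Hv] := @linear_positivity R n Omega rho v d2 d T (a2 + b2 * Bv + c2 * Bu)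
    oO bO Crho regv (ltW d20) d0.
- by rewrite !addr_ge0 // ?mulr_ge0 // ltW.
- by have [] := init x Ox.
- have Oc : closure Omega x by exact: subset_closure.
  have tb' : 0 <= t <= T by clear -tb; lra.
  have ku : 1 <= 1 + k x * u x t.
    by rewrite lerDl mulr_ge0 ?k0 // (le_trans (ltW mu0)) // Hu.
  have ku0 : 0 < 1 + k x * u x t by apply: lt_le_trans ku.
  exists (a2 / (1 + k x * u x t) - b2 * v x t - c2 * u x t).
    apply: bound => //; [|exact: HBu|exact: HBv].
    by rewrite gtr0_norm ?divr_gt0 // ler_pdivrMr // ler_peMr // ltW.
  rewrite eqv //; [|by case/andP: tb].
  by field; rewrite gt_eqF.
exists (Num.min mu mv); first by rewrite lt_min mu0.
move=> x t Ox tb; split.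
  by apply: le_trans (Hu x t Ox tb); rewrite ge_min lexx.
by apply: le_trans (Hv x t Ox tb); rewrite ge_min lexx orbT.
Qed.

Theorem mainTheorem15 (R : realType) (n : nat) (Omega : set 'rV[R]_n)
  (rho : 'rV[R]_n -> R) (k : 'rV[R]_n -> R)
  (a1 a2 b1 b2 c1 c2 d1 d2 c d ktil : R) (u v : 'rV[R]_n -> R -> R) :
  open Omega -> connected Omega -> bounded_set Omega -> Omega !=set0 ->
  C1_defining_function Omega rho ->
  C1_closure Omega k -> (forall x, closure Omega x -> 0 <= k x) ->
  lebesgue_null [set x | closure Omega x /\ k x = 0] ->
  0 < a1 -> 0 < a2 -> 0 < b1 -> 0 < b2 -> 0 < c1 -> 0 < c2 -> 0 < d1 -> 0 < d2 ->
  0 < c -> 0 < d ->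
  is_solution Omega rho k a1 a2 b1 b2 c1 c2 d1 d2 c d u v ->
  (exists2 x0, closure Omega x0 & ktil = k x0) ->
  (forall x, closure Omega x -> k x <= ktil) ->
  ktil > (a2 * b1 ^+ 2 - c2 * a1 * b1) / (a1 ^+ 2 * c2) ->
  a1 / a2 > Num.max (b1 / c2) (c1 / b2) ->
  forall eps : R, 0 < eps -> exists T : R, forall t x, T <= t -> Omega x ->
    `|u x t - a1 / b1| < eps /\ `|v x t| < eps.
Proof.
move=> oO _ bO _ Crho _ k0 _ a10 a20 b10 b20 c10 c20 d10 d20 c0 d0 sol _ _ _ hmax eps eps0.
have [regu regv] := solution_regular sol.
have [_ [_ [_ [_ [equ [eqv _]]]]]] := sol.
have pos T := @solution_positive R n Omega rho k a1 a2 b1 b2 c1 c2 d1 d2 c d T u v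
  oO bO Crho k0 a10 a20 b10 b20 c10 c20 d10 d20 c0 d0 sol.
have nn x t : Omega x -> 0 < t -> 0 <= u x t /\ 0 <= v x t.
  move=> Ox t0; have [m m0 Hm] := pos t.
  have [||mu mv] := Hm x t; [exact: subset_closure|by rewrite ltW //=|].
  by split; exact: le_trans (ltW m0) _.
have [h1 h2] : a2 * b1 < a1 * c2 /\ a2 * c1 < a1 * b2.
  move: hmax; rewrite gt_max => /andP[H1 H2]; split; [move: H1|move: H2].
    by rewrite ltr_pdivlMr // mulrAC ltr_pdivrMr // (mulrC b1).
  by rewrite ltr_pdivlMr // mulrAC ltr_pdivrMr // (mulrC c1).
have ufac x t : Omega x -> 0 < t ->
    'D_1 (u x) t - d1 * laplacian (u ^~ t) x = u x t * (a1 - b1 * u x t - c1 * v x t).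
  by move=> Ox t0; rewrite equ //; ring.
have vfac x t : Omega x -> 0 < t ->
    'D_1 (v x) t - d2 * laplacian (v ^~ t) x <= v x t * (a2 - b2 * v x t - c2 * u x t).
  move=> Ox t0; have [u0 v0] := nn x t Ox t0.
  have ku : 1 <= 1 + k x * u x t.
    by rewrite lerDl mulr_ge0 ?k0 //; exact: subset_closure.
  have ku0 : 0 < 1 + k x * u x t by apply: lt_le_trans ku.
  have av : a2 * v x t / (1 + k x * u x t) <= a2 * v x t.
    by rewrite ler_pdivrMr // ler_peMr // mulr_ge0 // ltW.
  by rewrite eqv //; clear -av; lra.
have [T1 T10 HT1] : exists2 T, 0 <= T & forall x t, closure Omega x -> T <= t -> u x t <= a1 / b1 + eps / 2.
  pose l := a1 / b1 + eps / 4.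
  have lb : a1 / b1 < l by rewrite ltrDl divr_gt0.
  have bl : 0 < b1 * l - a1 by rewrite subr_gt0 mulrC -ltr_pdivrMr.
  have l0 : 0 < l by apply: lt_trans lb; rewrite divr_gt0.
  apply: (@eventual_upper_bound R n Omega rho u d1 0 l _ (l * (b1 * l - a1))) => //.
  - exact: ltW.
  - by rewrite /l; clear -eps0; lra.
  - by rewrite mulr_gt0.
  - have [B _ HB] := neumann_regular_bounded 0 bO regu.
    by exists B => x Ox; apply: le_trans (ler_norm _) (HB _ _ Ox _); rewrite lexx.
  - move=> x t Ox t0 lu; have [u0 v0] := nn x t Ox t0.
    rewrite ufac //; apply: le_trans (logistic_decay a10 b10 lb lu).
    by rewrite ler_wpM2l // gerBl mulr_ge0 // ltW.
pose g := a1 / c1 - a2 / b2.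
have g0 : 0 < g by rewrite subr_gt0 ltr_pdivrMr // mulrAC ltr_pdivlMr.
have ab0 : 0 < a2 / b2 by rewrite divr_gt0.
pose be := a2 / b2 + g / 2.
pose be0 := a2 / b2 + g * 3 / 4.
have [T2 T20 HT2] : exists2 T, 0 <= T & forall x t, closure Omega x -> T <= t -> v x t <= be.
  pose l := a2 / b2 + g / 4.
  have lb : a2 / b2 < l by rewrite ltrDl divr_gt0.
  have bl : 0 < b2 * l - a2 by rewrite subr_gt0 mulrC -ltr_pdivrMr.
  have l0 : 0 < l by apply: lt_trans lb.
  apply: (@eventual_upper_bound R n Omega rho v d2 0 l _ (l * (b2 * l - a2))) => //.
  - exact: ltW.
  - by rewrite /l /be; clear -g0; lra.
  - by rewrite mulr_gt0.
  - have [B _ HB] := neumann_regular_bounded 0 bO regv.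
    by exists B => x Ox; apply: le_trans (ler_norm _) (HB _ _ Ox _); rewrite lexx.
  - move=> x t Ox t0 lv; have [u0 v0] := nn x t Ox t0.
    apply: le_trans (vfac x t Ox t0) _; apply: le_trans (logistic_decay a20 b20 lb lv).
    by rewrite ler_wpM2l // gerBl mulr_ge0 // ltW.
have [m m0 Hm] := pos T2.
have be00 : 0 < be0 by rewrite /be0; clear -g0 ab0; lra.
have eps4 : 0 < eps / 4 by rewrite divr_gt0.
have cb : c1 * be0 < a1.
  rewrite mulrC -ltr_pdivlMr // /be0; move: g0; rewrite /g; clear; lra.
have bb : a2 < b2 * be0.
  rewrite mulrC -ltr_pdivrMr // /be0; clear -g0; lra.
have [al0 [al1 [be1 [ka [[al01 be01 ka0 al0m al1e] [be1e k1 k2 k3 k4]]]]]] :=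
  corner_choice a10 a20 b10 b20 c10 c20 m0 eps4 be00 cb bb h1.
have [x t Ox T2t u0 v0|x t Ox T2t u0 v0|x t Ox T2t||T3 T23 HT3] :=
  @shrinking_rectangles R n Omega rho u v a1 a2 b1 b2 c1 c2 d1 d2 T2 al0 al1 be0 be1 ka (eps / 4)
    oO bO Crho regu regv b10 b20 c10 c20 (ltW d10) (ltW d20) T20 ka0 eps4 al01 be01 k1 k2 k3 k4.
- by rewrite ufac // (le_lt_trans T20).
- by rewrite vfac // (le_lt_trans T20).
- by apply: nn => //; exact: le_lt_trans T2t.
- exists (Num.min (m - al0) (g / 4)); first by rewrite lt_min subr_gt0 al0m divr_gt0.
  move=> x Ox; have [|mu _] := Hm x T2 Ox; first by rewrite T20 lexx.
  have e1 : Num.min (m - al0) (g / 4) <= m - al0 by rewrite ge_min lexx.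
  have e2 : Num.min (m - al0) (g / 4) <= g / 4 by rewrite ge_min lexx orbT.
  have := HT2 x T2 Ox (lexx _); rewrite /be /be0 => hv.
  by split; [clear -e1 mu; lra|clear -e2 hv; lra].
exists (Num.max 1 (Num.max T1 T3)) => t x; rewrite !ge_max => /and3P[t1 T1t T3t] Ox.
have Oc : closure Omega x by exact: subset_closure.
have t0 : 0 < t by apply: lt_le_trans t1.
have [u0 v0] := nn x t Ox t0.
have [ul vu] := HT3 x t Oc T3t.
have uu := HT1 x t Oc T1t.
split; first by rewrite ltr_norml; clear -uu ul al1e eps0; lra.
by rewrite ger0_norm //; clear -vu be1e eps0; lra.
Qed.
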